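(* Let $\mathcal{A}$ and $\mathcal{B}$ be Lie conformal algebras, let $f:\mathcal{A}\to\mathcal{B}$ be a triple homomorphism, and let $E$ be the enveloping Lie conformal algebra of $f(\mathcal{A})$ in $\mathcal{B}$. Assume that $\mathcal{A}$ is a finite simple Lie conformal algebra, and that $E$ is centerless and can be decomposed into a direct sum of indecomposable ideals. Then $f$ is either a homomorphism, an anti-homomorphism, or a direct sum of a homomorphism and an anti-homomorphism from $\mathcal{A}$ to $\mathcal{B}$.
   Context: All vector spaces are over $\mathbb{C}$. A Lie conformal algebra is a $\mathbb{C}[\partial]$-module $\mathcal{R}$ with a $\mathbb{C}$-linear map $\mathcal{R}\otimes\mathcal{R}\to\mathbb{C}[\lambda]\otimes\mathcal{R}$, $a\otimes b\mapsto[a_\lambda b]$, satisfying $[\partial a_\lambda b]=-\lambda[a_\lambda b]$, $[a_\lambda\partial b]=(\partial+\lambda)[a_\lambda b]$, $[a_\lambda b]=-[b_{-\lambda-\partial}a]$, and $[a_\lambda[b_\mu c]]=[[a_\lambda b]_{\lambda+\mu}c]+[b_\mu[a_\lambda c]]$. It is finite if it is finitely generated as a $\mathbb{C}[\partial]$-module; it is simple if it has no non-trivial ideals and is not abelian. Its center is $Z(\mathcal{R})=\{a:[a_\lambda b]=0\ \forall b\in\mathcal{R}\}$, and it is centerless if $Z(\mathcal{R})=0$. It is indecomposable if it cannot be written as a direct sum of two nontrivial (nonzero) ideals. For a subset $S$ of a Lie conformal algebra, the enveloping Lie conformal algebra of $S$ is the Lie conformal subalgebra generated by $S$. A $\mathbb{C}[\partial]$-module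 homomorphism $f:\mathcal{A}\to\mathcal{B}$ is: a homomorphism if $f([a_\lambda b])=[f(a)_\lambda f(b)]$ for all $a,b\in\mathcal{A}$; an anti-homomorphism if $f([a_\lambda b])=-[f(a)_\lambda f(b)]$ for all $a,b\in\mathcal{A}$; a triple homomorphism if $f([a_\lambda[b_\mu c]])=[f(a)_\lambda[f(b)_\mu f(c)]]$ for all $a,b,c\in\mathcal{A}$. A $\mathbb{C}[\partial]$-module homomorphism $f:\mathcal{A}\to\mathcal{B}$ is called a direct sum of $f_1$ and $f_2$ if $f=f_1+f_2$ and there exist ideals $I_1,I_2$ of the enveloping Lie conformal algebra of $f(\mathcal{A})$ such that $I_1\cap I_2=0$, $f_1(\mathcal{A})\subseteq I_1$ and $f_2(\mathcal{A})\subseteq I_2$. *)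

(* Defs.v *)
From HB Require Import structures.
From mathcomp Require Import all_boot all_order all_algebra finmap.
From mathcomp Require Import boolp classical_sets reals.
From mathcomp Require Import complex.

Set Implicit Arguments.
Unset Strict Implicit.
Unset Printing Implicit Defensive.

Import GRing.Theory.
Local Open Scope classical_set_scope.
Local Open Scope ring_scope.

(* A K[d]-module is an lmodType over {poly K}, the indeterminate acting as d. *)
Definition der (K : fieldType) (V : lmodType {poly K}) (x : V) : V := 'X *: x.

(* K[lambda] (x) V is {fsfun nat -> V with 0}: an element is the finitely
   supported family of its lambda-coefficients, and [lbr a b n] is the
   coefficient of lambda^n in [a_lambda b]. The axioms compare coefficients of
   lambda^n, resp. lambda^i mu^j. Polynomial coefficients are in
   - lbrC:      K[d][lambda], as {poly {poly K}} with 'X = lambda, 'X%:P = d;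
   - lbr_jacobi: K[lambda][mu], as {poly {poly K}} with 'X = mu, 'X%:P = lambda. *)
HB.mixin Record isLieConformal (K : fieldType) A
    of GRing.Lmodule {poly K} A := {
  lbr : A -> A -> {fsfun nat -> A with 0};
  lbr_linl : forall (c : K) (a a' b : A) (n : nat),
    lbr (c%:P *: a + a') b n = c%:P *: lbr a b n + lbr a' b n;
  lbr_linr : forall (c : K) (a b b' : A) (n : nat),
    lbr a (c%:P *: b + b') n = c%:P *: lbr a b n + lbr a b' n;
  (* [d a_lambda b] = - lambda [a_lambda b] *)
  lbr_derl : forall (a b : A) (n : nat),
    lbr (der a) b n = - (if n is m.+1 then lbr a b m else 0);
  (* [a_lambda d b] = (d + lambda) [a_lambda b] *)
  lbr_derr : forall (a b : A) (n : nat),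
    lbr a (der b) n = der (lbr a b n) + (if n is m.+1 then lbr a b m else 0);
  (* [a_lambda b] = - [b_(- lambda - d) a] *)
  lbrC : forall (a b : A) (n : nat),
    lbr a b n = - (\sum_(m <- finsupp (lbr b a))
                     ((- 'X - 'X%:P) ^+ m : {poly {poly K}})`_n *: lbr b a m);
  (* [a_lambda [b_mu c]] = [[a_lambda b]_(lambda + mu) c] + [b_mu [a_lambda c]] *)
  lbr_jacobi : forall (a b c : A) (i j : nat),
    lbr a (lbr b c j) i =
      (\sum_(m <- finsupp (lbr a b)) \sum_(k <- finsupp (lbr (lbr a b m) c))
         (('X%:P ^+ m * ('X%:P + 'X) ^+ k : {poly {poly K}})`_j`_i)%:P
           *: lbr (lbr a b m) c k)
      + lbr b (lbr a c i) j
}.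

#[short(type="lieConformalType")]
HB.structure Definition LieConformal (K : fieldType) :=
  {A of isLieConformal K A & GRing.Lmodule {poly K} A}.

Section Subobjects.
Variables (K : fieldType) (A : lieConformalType K).
Implicit Types S I E : set A.

Definition is_submodule S :=
  S 0 /\ forall (p : {poly K}) (x y : A), S x -> S y -> S (p *: x + y).

Definition is_subalgebra S :=
  is_submodule S /\ forall (a b : A) (n : nat), S a -> S b -> S (lbr a b n).

Definition enveloping S : set A := smallest is_subalgebra S.

(* The notions below concern a subalgebra E as a Lie conformal algebra in its
   own right; E = setT gives the notion for A itself. *)
Definition is_ideal E I :=
  [/\ I `<=` E, is_submodule I
    & forall (a b : A) (n : nat), E a -> I b -> I (lbr a b n)].

Definition abelian E :=
  forall (a b : A) (n : nat), E a -> E b -> lbr a b n = 0.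

Definition simple E :=
  (forall I, is_ideal E I -> I = [set 0] \/ I = E) /\ ~ abelian E.

Definition center E : set A :=
  [set a | E a /\ forall (b : A) (n : nat), E b -> lbr a b n = 0].

Definition centerless E := center E = [set 0].

(* Every element of E is uniquely a finite sum of elements of the D j; the
   index type need not be finite. *)
Definition direct_sum_of E (J : choiceType) (D : J -> set A) :=
  (forall j, D j `<=` E) /\
  forall x, E x -> exists! u : {fsfun J -> A with 0},
    (forall j, D j (u j)) /\ x = \sum_(j <- finsupp u) u j.

Definition indecomposable E :=
  ~ exists D : bool -> set A,
      (forall j, is_ideal E (D j) /\ D j <> [set 0]) /\ direct_sum_of E D.

Definition sum_of_indecomposable_ideals E :=
  exists (J : choiceType) (D : J -> set A),
    (forall j, is_ideal E (D j) /\ indecomposable (D j)) /\ direct_sum_of E D.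

Definition finite_conformal :=
  exists (n : nat) (g : 'I_n -> A),
    forall a : A, exists p : 'I_n -> {poly K}, a = \sum_(i < n) p i *: g i.

End Subobjects.

Section Morphisms.
Variables (K : fieldType) (A B : lieConformalType K).

Definition is_homomorphism (f : {linear A -> B}) :=
  forall (a b : A) (n : nat), f (lbr a b n) = lbr (f a) (f b) n.

Definition is_antihomomorphism (f : {linear A -> B}) :=
  forall (a b : A) (n : nat), f (lbr a b n) = - lbr (f a) (f b) n.

Definition is_triple_homomorphism (f : {linear A -> B}) :=
  forall (a b c : A) (i j : nat),
    f (lbr a (lbr b c j) i) = lbr (f a) (lbr (f b) (f c) j) i.

Definition is_direct_sum (f f1 f2 : {linear A -> B}) :=
  (forall a, f a = f1 a + f2 a) /\
  exists I1 I2 : set B,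
    [/\ is_ideal (enveloping (range f)) I1,
        is_ideal (enveloping (range f)) I2,
        I1 `&` I2 = [set 0],
        range f1 `<=` I1
      & range f2 `<=` I2].

End Morphisms.

(* Main.v *)
From HB Require Import structures.
Require Import Defs.
From mathcomp Require Import all_boot all_order all_algebra.
From mathcomp Require Import finmap boolp.
From mathcomp Require Import classical_sets reals.
From mathcomp Require Import complex.
Import GRing.Theory.
Local Open Scope classical_set_scope.
Local Open Scope ring_scope.
Local Open Scope complex_scope.

(** Let [E] be the enveloping algebra of [f(A)]. Since [A] is perfect and [E] is
    centerless, each [x] in [A] has a unique companion [d x] in [E] such that
    [[d x_lambda f c] = f [x_lambda c]] for all [c]; on brackets it is given by
    [d [a_lambda b] = [f a_lambda f b]]. The map [d] is a homomorphism, hence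
    [(f + d) / 2] is a homomorphism, [(f - d) / 2] is an anti-homomorphism, and
    their ranges commute. As [E] is the sum of these ranges, the ranges are
    ideals of [E] and their intersection is central in [E], so it is zero. *)

(** * The bracket, centralizers and perfectness *)

Section Bracket.
Context {K : fieldType} {A : lieConformalType K}.
Implicit Types (a b : A) (S : set A).

Lemma lbrDl a a' b n : lbr (a + a') b n = lbr a b n + lbr a' b n.
Proof. by have := lbr_linl 1 a a' b n; rewrite !scale1r. Qed.

Lemma lbrDr a b b' n : lbr a (b + b') n = lbr a b n + lbr a b' n.
Proof. by have := lbr_linr 1 a b b' n; rewrite !scale1r. Qed.

Lemma lbr0l b n : lbr 0 b n = 0 :> A.
Proof. by apply: (addrI (lbr 0 b n)); rewrite -lbrDl !addr0. Qed.

Lemma lbr0r a n : lbr a 0 n = 0 :> A.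
Proof. by apply: (addrI (lbr a 0 n)); rewrite -lbrDr !addr0. Qed.

Lemma lbrZl (c : K) a b n : lbr (c%:P *: a) b n = c%:P *: lbr a b n.
Proof. by have := lbr_linl c a 0 b n; rewrite lbr0l !addr0. Qed.

Lemma lbrZr (c : K) a b n : lbr a (c%:P *: b) n = c%:P *: lbr a b n.
Proof. by have := lbr_linr c a b 0 n; rewrite lbr0r !addr0. Qed.

Lemma lbrNl a b n : lbr (- a) b n = - lbr a b n.
Proof. by apply: (addrI (lbr a b n)); rewrite -lbrDl !subrr lbr0l. Qed.

Lemma lbrNr a b n : lbr a (- b) n = - lbr a b n.
Proof. by apply: (addrI (lbr a b n)); rewrite -lbrDr !subrr lbr0r. Qed.

(** By Horner induction, closure under constants and [der] suffices; these are the only scalars for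
    which the bracket axioms are stated. *)
Lemma is_submodule_der S :
  S 0 -> (forall x y, S x -> S y -> S (x + y)) ->
  (forall (c : K) x, S x -> S (c%:P *: x)) -> (forall x, S x -> S (der x)) ->
  is_submodule S.
Proof.
move=> S0 SD SZ Sder; split=> // p x y Sx Sy; apply: (SD) => //.
elim/poly_ind: p => [|p c IH]; first by rewrite scale0r.
by rewrite scalerDl mulrC -scalerA; apply: SD; [apply: Sder | apply: SZ].
Qed.

Lemma is_submoduleP S : is_submodule S ->
  [/\ S 0, forall x y, S x -> S y -> S (x + y)
    & forall p x, S x -> S (p *: x)].
Proof.
move=> [S0 SL]; split=> // [x y Sx Sy|p x Sx].
  by rewrite -[x]scale1r; apply: SL.
by rewrite -[_ *: _]addr0; apply: SL.
Qed.

(** By Jacobi, each term of a bracket of [a] with [[x, y]] contains a bracket of [a] with [x] or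
    [y]. Hence commuting with generators is enough. *)
Lemma centralizer_subalgebra a :
  is_subalgebra [set b | forall n, lbr a b n = 0].
Proof.
split.
  apply: is_submodule_der => /=.
  - by move=> n; apply: lbr0r.
  - by move=> x y ax ay n; rewrite lbrDr ax ay addr0.
  - by move=> c x ax n; rewrite lbrZr ax scaler0.
  - by move=> x ax [|n]; rewrite lbr_derr /der !ax scaler0 addr0.
move=> x y j /= ax ay i; rewrite lbr_jacobi ay lbr0r addr0.
rewrite big1 // => m _; rewrite big1 // => k _.
by rewrite ax lbr0l scaler0.
Qed.

(** Such an [S] is an ideal, and it is nonzero because [A] is not abelian. This acts as an induction
    principle: a property stable under the module operations need only be checked on brackets. *)
Lemma simple_perfect S : simple [set: A] -> is_submodule S ->
  (forall a b n, S (lbr a b n)) -> forall x, S x.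
Proof.
move=> [simpA nabA] subS Sbr x.
have [S0|->//] := simpA S (And3 (@subsetT _ S) subS (fun a b n _ _ => Sbr a b n)).
by case: nabA => a b n _ _; have := Sbr a b n; rewrite S0.
Qed.

End Bracket.

(** The sums in [lbrC] and [lbr_jacobi] run over supports of brackets, which may shrink under a
    linear map; the missing terms are zero. *)
Lemma big_finsupp_sub (V V' W : nmodType) (u : {fsfun nat -> V with 0})
    (v : {fsfun nat -> V' with 0}) (F : nat -> W) :
  (forall m, u m = 0 -> v m = 0) -> (forall m, v m = 0 -> F m = 0) ->
  \sum_(m <- finsupp v) F m = \sum_(m <- finsupp u) F m.
Proof.
move=> uv vF; apply: big_fset_incl => [|m _]; last first.
  by rewrite memNfinsupp => /eqP/vF.
apply/fsubsetP => m; rewrite !mem_finsupp; apply: contra_neq; exact: uv.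
Qed.

(** Skew-symmetry writes the swapped bracket as a combination of the original coefficients, with the
    same polynomials in [A] and in [B]. *)
Lemma lbrC_transfer {K : fieldType} {A B : lieConformalType K}
    (h : {linear A -> B}) (a b : A) (a' b' : B) :
  (forall n, lbr a' b' n = h (lbr a b n)) ->
  forall n, lbr b' a' n = h (lbr b a n).
Proof.
move=> hab n; rewrite [LHS]lbrC [in RHS]lbrC linearN; congr (- _); rewrite linear_sum.
rewrite (@big_finsupp_sub _ _ _ (lbr a b)).
- by apply: eq_bigr => m _; rewrite linearZ /= hab.
- by move=> m abm; rewrite hab abm linear0.
- by move=> m ->; rewrite scaler0.
Qed.

Lemma exists_linear {R : pzRingType} {V W : lmodType R} (g : V -> W) :
  linear g -> exists h : {linear V -> W}, forall x, h x = g x.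
Proof.
move=> lin_g.
pose M := GRing.isLinear.Build R V W *:%R g lin_g.
pose h : {linear V -> W} := HB.pack g M.
by exists h.
Qed.

(** * The companion map of a triple homomorphism *)

Section TripleHomomorphism.
Context {K : fieldType} {A B : lieConformalType K} (f : {linear A -> B}).
Hypothesis f_triple : is_triple_homomorphism f.
Hypothesis A_simple : simple [set: A].
Hypothesis E_centerless : centerless (enveloping (range f)).
Hypothesis two_neq0 : 2 != 0 :> K.

Local Notation E := (enveloping (range f)).

Lemma enveloping_subalgebra : is_subalgebra E.
Proof.
split; first split=> [S [[[]]]//|p x y Ex Ey S SE].
  by case: (SE) => -[[_ SL] _] _; apply: SL; [apply: Ex | apply: Ey].
by move=> a b n Ea Eb S SE; case: (SE) => -[_ Sbr] _; apply: Sbr;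
  [apply: Ea | apply: Eb].
Qed.

Lemma enveloping_range x : E (f x).
Proof. by move=> S [_]; apply; exists x. Qed.

(** The centralizer of [y] is a subalgebra containing [range f], hence all of [E], so [y] is central
    in [E]. *)
Lemma enveloping_centralizer_eq0 y :
  E y -> (forall c n, lbr y (f c) n = 0) -> y = 0.
Proof.
move=> Ey yf; suff : center E y by rewrite E_centerless.
split=> // b n Eb; apply: (Eb [set b | forall n, lbr y b n = 0]).
by split; [apply: centralizer_subalgebra | move=> _ [c _ <-]; apply: yf].
Qed.

Definition companion (x : A) (y : B) :=
  E y /\ forall c n, lbr y (f c) n = f (lbr x c n).

Lemma companion_unique x y z : companion x y -> companion x z -> y = z.
Proof.
move=> [Ey yx] [Ez zx]; apply/eqP; rewrite -subr_eq0; apply/eqP.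
have [[E0 EL] _] := enveloping_subalgebra.
apply: enveloping_centralizer_eq0 => [|c n].
  by rewrite addrC -scaleN1r; apply: EL.
by rewrite lbrDl lbrNl yx zx subrr.
Qed.

Lemma companionD x y x' y' :
  companion x y -> companion x' y' -> companion (x + x') (y + y').
Proof.
move=> [Ey yx] [Ey' yx']; split=> [|c n].
  by have [/is_submoduleP[_ ED _] _] := enveloping_subalgebra; apply: ED.
by rewrite !lbrDl yx yx' linearD.
Qed.

Lemma companionZ p x y : companion x y -> companion (p *: x) (p *: y).
Proof.
have [/is_submoduleP[E0 ED EZ] _] := enveloping_subalgebra.
move=> xy; elim/poly_ind: p => [|p k IH].
  by rewrite !scale0r; split=> // c n; rewrite !lbr0l linear0.
rewrite !scalerDl mulrC -!scalerA; apply: companionD.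
  (* On both sides ['X] shifts the coefficients by one and changes their sign, leaving zero in
     degree 0. *)
  case: IH => Epy pyx; split=> [|c [|n]]; first exact: EZ.
    by rewrite !lbr_derl !oppr0 linear0.
  by rewrite !lbr_derl pyx linearN.
case: xy => Ey yx; split=> [|c n]; first exact: EZ.
by rewrite !lbrZl yx linearZ.
Qed.

(** The triple identity brackets with [f c] on the left; skew-symmetry moves it to the right. *)
Lemma companion_lbr a b n : companion (lbr a b n) (lbr (f a) (f b) n).
Proof.
have [_ Ebr] := enveloping_subalgebra.
split; first by apply: Ebr; apply: enveloping_range.
by move=> c; apply: lbrC_transfer => m; rewrite f_triple.
Qed.

Lemma companion_exists x : exists y, companion x y.
Proof.
apply: (@simple_perfect _ _ [set x | exists y, companion x y] A_simple).
  split=> [|p a b [y ay] [z bz]].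
    by exists 0; have := companion_lbr 0 0 0; rewrite linear0 !lbr0l.
  by exists (p *: y + z); apply: companionD => //; apply: companionZ.
by move=> a b n; exists (lbr (f a) (f b) n); apply: companion_lbr.
Qed.

Lemma companion_linear :
  exists d : {linear A -> B}, forall x, companion x (d x).
Proof.
have [d dP] := choice companion_exists.
have [|h hd] := @exists_linear _ A B d; last by exists h => x; rewrite hd.
move=> p x y; apply: companion_unique (dP _) _.
by apply: companionD => //; apply: companionZ.
Qed.

Lemma companion_homomorphism (d : {linear A -> B}) :
  (forall x, companion x (d x)) -> is_homomorphism d.
Proof.
move=> dP x y.
have dlbr a b n : d (lbr a b n) = lbr (f a) (f b) n.
  exact: companion_unique (dP _) (companion_lbr _ _ _).
have dl z c n : lbr (d z) (f c) n = f (lbr z c n) by case: (dP z).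
pose S := [set y | forall n, lbr (d x) (d y) n = d (lbr x y n)].
suff Sy : S y by move=> n; rewrite Sy.
apply: (@simple_perfect _ _ S A_simple) => [|a b j i].
  apply: is_submodule_der => [n|u v Su Sv n|c u Su n|u Su n]; rewrite /=.
  - by rewrite linear0 !lbr0r linear0.
  - by rewrite linearD !lbrDr linearD Su Sv.
  - by rewrite linearZ /= !lbrZr linearZ /= Su.
  - rewrite {1}/der linearZ /= -/(der _) !lbr_derr linearD /= Su /der linearZ /=.
    by case: n => [|n]; rewrite ?linear0 ?Su.
(* After Jacobi on both sides, every inner bracket pairs [d x] with a value of [f] and gives a value
   of [f]; the outer bracket of two values of [f] is then a value of [d]. *)
rewrite dlbr [LHS]lbr_jacobi [lbr x _ i]lbr_jacobi linearD /= dl dlbr.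
congr (_ + _); rewrite linear_sum.
rewrite (@big_finsupp_sub _ _ _ (lbr x a)).
- apply: eq_bigr => m _; rewrite linear_sum.
  rewrite (@big_finsupp_sub _ _ _ (lbr (lbr x a m) b)).
  + by apply: eq_bigr => k _; rewrite linearZ /= dlbr dl.
  + by move=> k e; rewrite dl -dlbr e linear0.
  + by move=> k ->; rewrite scaler0.
- by move=> m e; rewrite dl e linear0.
- by move=> m e; rewrite big1 // => k _; rewrite e lbr0l scaler0.
Qed.

(** * Splitting into homomorphic and anti-homomorphic parts *)

Lemma half_scaleD (V : lmodType {poly K}) (v : V) :
  (2^-1 : K)%:P *: (v + v) = v.
Proof.
rewrite -mulr2n -scaler_nat scalerA -polyC_natr -polyCM mulVf //.
by rewrite scale1r.
Qed.

Lemma triple_homomorphism_decomposition :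
  exists f1 f2 : {linear A -> B},
    [/\ is_homomorphism f1, is_antihomomorphism f2 & is_direct_sum f f1 f2].
Proof.
have [d dP] := companion_linear.
have dd : is_homomorphism d := companion_homomorphism _ dP.
(* The maps [d] and [f] multiply like the unit and the generator of the group algebra of Z/2. Thus
   [f1] below corresponds to one idempotent and [f2] to minus the other, whence its sign. *)
have ff a b n : lbr (f a) (f b) n = d (lbr a b n).
  exact: companion_unique (companion_lbr _ _ _) (dP _).
have df a b n : lbr (d a) (f b) n = f (lbr a b n) by case: (dP a).
have fd a b n : lbr (f a) (d b) n = f (lbr a b n).
  by apply: lbrC_transfer => m; apply: df.
pose s : {poly K} := (2^-1 : K)%:P.
have [|f1 f1E] := @exists_linear _ A B (fun x => s *: (f x + d x)).
  move=> p x y; rewrite !linearP /= addrACA -(scalerDr p) [LHS]scalerDr !scalerA.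
  by rewrite [s * p]mulrC.
have [|f2 f2E] := @exists_linear _ A B (fun x => s *: (f x - d x)).
  move=> p x y; rewrite (linearP f) (linearP d) opprD addrACA -(scalerBr p) [LHS]scalerDr !scalerA.
  by rewrite [s * p]mulrC.
have fE x : f x = f1 x + f2 x.
  by rewrite f1E f2E -scalerDr addrACA subrr addr0 half_scaleD.
have hom1 a b n : lbr (f1 a) (f1 b) n = f1 (lbr a b n).
  rewrite !f1E lbrZl lbrZr !lbrDl !lbrDr ff df fd -dd [f _ + _]addrC.
  by rewrite half_scaleD.
have hom2 a b n : lbr (f2 a) (f2 b) n = - f2 (lbr a b n).
  rewrite !f2E lbrZl lbrZr !lbrDl !lbrDr !lbrNl !lbrNr ff df fd -dd opprK.
  by rewrite [- f _ + _]addrC half_scaleD -scalerN opprB.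
have com12 a b n : lbr (f1 a) (f2 b) n = 0.
  rewrite f1E f2E lbrZl lbrZr !lbrDl !lbrDr !lbrNr ff df fd -dd.
  by rewrite [f _ - _]addrC addrACA subrr addNr addr0 !scaler0.
have com21 a b n : lbr (f2 a) (f1 b) n = 0.
  rewrite f1E f2E lbrZl lbrZr !lbrDl !lbrDr !lbrNl ff df fd -dd.
  by rewrite -opprD [d _ + _]addrC subrr !scaler0.
have [/is_submoduleP[E0 ED EZ] Ebr] := enveloping_subalgebra.
have Ed x : E (d x) by case: (dP x).
have E1 x : E (f1 x).
  by rewrite f1E; apply: EZ; apply: ED => //; apply: enveloping_range.
have E2 x : E (f2 x).
  rewrite f2E; apply: (EZ); apply: ED; first exact: enveloping_range.
  by rewrite -scaleN1r; apply: EZ.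
have range_submodule (g : {linear A -> B}) : is_submodule (range g).
  split; first by exists 0; rewrite ?linear0.
  by move=> p _ _ [x _ <-] [y _ <-]; exists (p *: x + y); rewrite ?linearP.
(* Since mixed brackets vanish, these sums form a subalgebra; it contains each [f x], with
   [u = v = x]. *)
have EP a : E a -> exists u v, a = f1 u + f2 v.
  move=> Ea; apply: (Ea [set x | exists u v, x = f1 u + f2 v]).
  split; last by move=> _ [x _ <-]; exists x, x.
  split.
    split; first by exists 0, 0; rewrite !linear0 addr0.
    move=> p _ _ [u [v ->]] [u' [v' ->]]; exists (p *: u + u'), (p *: v + v').
    by rewrite !linearP /= scalerDr addrACA.
  move=> _ _ n [u [v ->]] [u' [v' ->]]; exists (lbr u u' n), (- lbr v v' n).
  by rewrite !lbrDl !lbrDr hom1 hom2 com12 com21 addr0 add0r linearN.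
exists f1, f2; split=> // [a b n|]; first by rewrite hom2 opprK.
split=> //; exists (range f1), (range f2); split=> //.
- split=> // [_ [x _ <-] //|a _ n /EP[u [v ->]] [w _ <-]].
  by exists (lbr u w n); rewrite // lbrDl hom1 com21 addr0.
- split=> // [_ [x _ <-] //|a _ n /EP[u [v ->]] [w _ <-]].
  by exists (- lbr v w n); rewrite // lbrDl hom2 com12 add0r linearN.
(* A common element [z] kills [f1 c] when written as [f2 y], and [f2 c] when written as [f1 x]; so
   it commutes with every [f c]. *)
- apply/seteqP; split=> [z [[x _ xz] [y _ yz]]|_ ->].
    apply: enveloping_centralizer_eq0 => [|c n]; first by rewrite -xz.
    by rewrite fE lbrDr -{1}yz -xz com12 com21 addr0.
  by split; exists 0; rewrite ?linear0.
Qed.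

End TripleHomomorphism.

Theorem theorem5p8 (R : realType) (A B : lieConformalType R[i])
    (f : {linear A -> B}) :
  is_triple_homomorphism f ->
  finite_conformal A ->
  simple [set: A] ->
  centerless (enveloping (range f)) ->
  sum_of_indecomposable_ideals (enveloping (range f)) ->
  [\/ is_homomorphism f,
      is_antihomomorphism f
    | exists f1 f2 : {linear A -> B},
        [/\ is_homomorphism f1, is_antihomomorphism f2
          & is_direct_sum f f1 f2]].
Proof.
(* The first two alternatives are the cases where one summand is zero, so the third covers
   everything. *)
move=> f_triple _ A_simple E_centerless _; apply: Or33.
apply: triple_homomorphism_decomposition => //.
by rewrite Num.Theory.pnatr_eq0.
Qed.
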